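(* Let $K$ be a $\sigma$-compact functionally closed subset of a topological vector space $X$. If $K$ is contained in the boundary $\partial U$ of some strictly convex open set $U\subset X$, then every $F_\sigma$-measurable function $f:K\to Y$ to a Banach space $Y$ can be extended to an $F_\sigma$-measurable linearly continuous function $\bar f:X\to Y$.
   Context: All topological vector spaces are over $\mathbb R$ and are assumed to be Hausdorff. $\partial U$ denotes the topological boundary of $U$ in $X$; $K$ carries the subspace topology. A subset $C$ of a topological vector space $X$ is strictly convex if for any distinct points $x,y\in\overline{C}$ the open segment $(x;y)=\{(1-t)x+ty:0<t<1\}$ is contained in $C$. A subset $U$ of a topological space $X$ is functionally open if $U=g^{-1}(V)$ for some continuous $g:X\to\mathbb R$ and some open $V\subseteq\mathbb R$; a subset is functionally closed if its complement is functionally open. A function $f:X\to Y$ between topological spaces is $F_\sigma$-measurable if for every functionally open $U\subset Y$ the preimage $f^{-1}(U)$ is of type $F_\sigma$ in $X$ (a countable union of closed sets). A function $f:X\to Y$ from a topological vector space $X$ to a topological space $Y$ is linearly continuous if for any $x,v\in X$ the function $\mathbb R\to Y$, $t\mapsto f(x+tv)$, is continuous. *)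

(* Defs.v *)
From HB Require Import structures.
From mathcomp Require Import all_boot all_order all_algebra.
From mathcomp Require Import all_classical all_reals all_analysis.
From mathcomp Require Import borel_hierarchy.

Set Implicit Arguments.
Unset Strict Implicit.
Unset Printing Implicit Defensive.

Import Order.TTheory GRing.Theory Num.Theory.
Import numFieldNormedType.Exports.

Local Open Scope classical_set_scope.
Local Open Scope ring_scope.

Definition boundary (T : topologicalType) (U : set T) : set T :=
  closure U `\` interior U.

Definition sigma_compact (T : topologicalType) (K : set T) : Prop :=
  exists2 F : (set T)^nat, (forall n, compact (F n)) & K = \bigcup_n F n.

Definition functionally_open (R : realType) (T : topologicalType)
    (U : set T) : Prop :=
  exists (g : T -> R) (V : set R),
    [/\ continuous g, open V & U = g @^-1` V].

Definition functionally_closed (R : realType) (T : topologicalType)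
    (A : set T) : Prop :=
  functionally_open R (~` A).

Definition Fsigma_measurable (R : realType) (S T : topologicalType)
    (f : S -> T) : Prop :=
  forall U : set T, functionally_open R U -> Fsigma (f @^-1` U).

(* The endpoints range over the closure of C, while the open segment has to lie
   in C itself. *)
Definition strictly_convex (R : realType) (X : topologicalLmodType R)
    (C : set X) : Prop :=
  forall x y : X, closure C x -> closure C y -> x <> y ->
    forall t : R, 0 < t < 1 -> C ((1 - t) *: x + t *: y).

Definition linearly_continuous (R : realType) (X : topologicalLmodType R)
    (Y : topologicalType) (f : X -> Y) : Prop :=
  forall x v : X, continuous (fun t : R => f (x + t *: v)).

(* Main.v *)
Require Import Defs.
From HB Require Import structures.
From mathcomp Require Import all_boot all_order all_algebra.
From mathcomp Require Import all_classical all_reals all_analysis.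
From mathcomp Require Import borel_hierarchy.
From mathcomp Require Import lra ring.
Import Order.TTheory GRing.Theory Num.Theory.
Import numFieldNormedType.Exports.
Local Open Scope classical_set_scope.
Local Open Scope ring_scope.

Set Implicit Arguments.
Unset Strict Implicit.
Unset Printing Implicit Defensive.

(** The proof has two halves: [f] is a pointwise limit on [K] of continuous
    functions defined on all of [X], and any such limit has a linearly continuous
    extension, because the oscillations of a well chosen interpolation of the
    approximations avoid the rays issued from the points of [K], near these points.

    First half. The range of [f] on [K] is separable: otherwise the preimages of
    an uncountable family of disjoint balls would be disjoint nonempty sets all
    of whose unions are sigma-compact, and a Cantor scheme of compact sets with a
    diagonal argument over its branches excludes this
    ([countable_compact_additive_family]). As [X] is completely regular, a
    compact set is separated from a disjoint sigma-compact set by a zero set, so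
    [K] is covered, at any scale, by countably many zero sets on which [f] is
    almost constant ([Fsigma_measurable_zero_set_net]). Continuous functions that
    give the first of these zero sets the highest priority converge to a step
    approximation of [f], and a diagonal argument over the scales yields
    continuous [F n] converging to [f] on [K]
    ([Fsigma_measurable_pointwise_limit]).

    Second half. Off [K] the extension interpolates between the [F n], with [n]
    tending to infinity near [K], at a speed governed by a continuous function
    [e] vanishing exactly on [K]. At [x] in [K] the danger is a point [y] close
    to [K] with [F n y] far from [F n x]. If [y] is close enough to [K], then it
    is close to some [b] in [K] other than [x], and strict convexity puts the
    midpoint of [x] and [b] in [U] and the reflection of [x] through [b] outside
    the closure of [U]; compactness in [x] makes this stable, so the same holds
    for [y], provided that [e] grows fast enough away from [K]
    ([gauge_controlling_oscillation]). But on one ray issued from [x] this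
    cannot happen at points arbitrarily close to [x]: one occurrence puts an
    initial segment of the ray in [U], which excludes the occurrences much closer
    to [x] ([ray_eventually_not_crosses]). Hence [F n y] follows [F n x] along
    every line through [x] and the extension tends to [f x]
    ([linearly_continuous_extension]). It is continuous off the zero set [K], so
    F-sigma measurability is inherited from [f]. *)

(** * Complete regularity of topological groups *)

Definition translation_entourage (X : topologicalZmodType) : set_system (X * X) :=
  fun P => exists2 U : set X, nbhs (0 : X) U &
    forall xy : X * X, U (xy.2 - xy.1) -> P xy.

Lemma translation_entourage_filter (X : topologicalZmodType) :
  Filter (@translation_entourage X).
Proof.
split; first by exists setT => //; exact: filterT.
  move=> P Q [U U0 UP] [V V0 VQ]; exists (U `&` V); first exact: filterI.
  by move=> xy [/UP ? /VQ].
by move=> P Q PQ [U U0 UP]; exists U => // xy /UP /PQ.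
Qed.

Lemma translation_entourage_refl (X : topologicalZmodType) A :
  @translation_entourage X A -> diagonal `<=` A.
Proof.
move=> [U U0 UA] xy xyE; apply: UA; rewrite (_ : xy.1 = xy.2) // subrr.
exact: nbhs_singleton.
Qed.

Lemma translation_entourage_inv (X : topologicalZmodType) A :
  @translation_entourage X A -> @translation_entourage X A^-1%relation.
Proof.
move=> [U U0 UA]; exists (-%R @^-1` U).
  by apply: (@opp_continuous X 0); rewrite oppr0.
by move=> [x y] /= Uxy; apply: UA => /=; rewrite -opprB.
Qed.

Lemma translation_entourage_split (X : topologicalZmodType) A :
  @translation_entourage X A ->
  exists2 B, @translation_entourage X B & (B \; B)%relation `<=` A.
Proof.
move=> [U U0 UA].
have /= := @add_continuous X (0, 0); rewrite /continuous_at /= addr0.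
move=> /(_ U U0) [[W1 W2] [/= W10 W20] W].
exists [set w | (W1 `&` W2) (w.2 - w.1)].
  by exists (W1 `&` W2) => //; exact: filterI.
move=> [x y] /= [z [Hx _] [_ Hy]]; apply: UA => /=.
rewrite (_ : y - x = (z - x) + (y - z)); last by rewrite [RHS]addrC addrA subrK.
exact: (W (z - x, y - z)).
Qed.

Lemma nbhs_translation_entourage (X : topologicalZmodType) :
  @nbhs X X = nbhs_ (@translation_entourage X).
Proof.
apply/funext => x; apply/funext => A; apply/propext; split.
  move=> xA; exists [set xy | A (x + (xy.2 - xy.1))].
    exists [set z | A (x + z)] => //.
    have : {for 0, continuous (fun z : X => x + z)}.
      apply: (@continuous_comp X (X * X)%type X (fun z => (x, z))
        (fun z : X * X => z.1 + z.2)); last exact: add_continuous.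
      by apply: cvg_pair; [exact: cvg_cst|exact: cvg_id].
    by apply; rewrite addr0.
  by move=> y /xsectionP /=; rewrite addrC subrK.
move=> [B [U U0 UB] BA]; apply: (@filterS _ _ _ [set y | U (y - x)]).
  by move=> y Uy; apply: BA; apply/xsectionP; apply: UB.
have : {for x, continuous (fun z : X => z - x)}.
  apply: (@continuous_comp X (X * X)%type X (fun z => (z, x))
    (fun z : X * X => z.1 - z.2)); last exact: sub_continuous.
  by apply: cvg_pair; [exact: cvg_id|exact: cvg_cst].
by apply; rewrite subrr.
Qed.

(** Topological groups are uniformizable by their translation-invariant
    entourages, and uniform spaces are completely regular. *)
Lemma topologicalZmod_completely_regular (R : realType) (X : topologicalZmodType) :
  completely_regular_space X.
Proof.
pose UX : uniformType := HB.pack (X : Type)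
  (Topological.on X)
  (Nbhs_isUniform_mixin.Build X (@translation_entourage_filter X)
    (@translation_entourage_refl X)
    (@translation_entourage_inv X) (@translation_entourage_split X)
    (@nbhs_translation_entourage X)).
exact: (@uniform_completely_regular R UX).
Qed.


(** * Functional separation and the gauge of a zero set *)

(** Otherwise the complements of the sets satisfying [P] would generate a proper
    filter on [A], and [P] would fail near any of its cluster points. *)
Lemma compact_ind (X : topologicalType) (A : set X) (P : set X -> Prop) :
  compact A -> P set0 -> (forall S T, S `<=` T -> P T -> P S) ->
  (forall S T, P S -> P T -> P (S `|` T)) ->
  (forall x, A x -> exists2 V, nbhs x V & P V) -> P A.
Proof.
move=> cA P0 Pmono PU Ploc; apply: contrapT => nPA.
pose G : set_system X := fun S => P (A `\` S).
have FG : ProperFilter G.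
  split; first by rewrite /G setD0.
  split.
  - by rewrite /G setDT.
  - by move=> S T; rewrite /G setDIr; exact: PU.
  - by move=> S T ST; apply: Pmono; exact: setDS.
have [|x [Ax xG]] := cA G FG; first by rewrite /G setDv.
have [V xV PV] := Ploc _ Ax.
have GV : G (~` V) by apply: Pmono PV => y [_]; exact: contrapT.
by have [y [nVy Vy]] := xG _ _ GV xV.
Qed.

(** Separations of the points of [A] from [B] add up, and are then cut off at
    [1]. *)
Lemma separate_compact_closed (R : realType) (X : topologicalType) (A B : set X) :
  completely_regular_space X -> compact A -> closed B ->
  (forall x, A x -> ~ B x) ->
  exists u : X -> R, [/\ continuous u, forall x, 0 <= u x <= 1,
    forall x, A x -> u x = 1 & forall x, B x -> u x = 0].
Proof.
move=> crX cA clB AB.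
pose P (S : set X) := exists u : X -> R, [/\ continuous u, forall x, 0 <= u x,
  forall x, S x -> 1 <= u x & forall x, B x -> u x = 0].
have [] : P A.
  apply: (compact_ind cA).
  - by exists (fun=> 0); split=> // x; exact: cvg_cst.
  - by move=> S T ST [u [cu u0 uT uB]]; exists u; split=> // x /ST /uT.
  - move=> S T [u [cu u0 uS uB]] [v [cv v0 vT vB]].
    exists (fun x => u x + v x); split.
    + by move=> x; apply: cvgD; [exact: cu|exact: cv].
    + by move=> x; rewrite addr_ge0.
    + move=> x [/uS ux|/vT vx]; first by rewrite -[1]addr0 lerD.
      by rewrite -[1]add0r lerD.
    + by move=> x Bx; rewrite uB// vB// addr0.
  - move=> a /AB nBa.
    have /(@uniform_separatorP _ R)[f [cf f01 fa fB]] := crX _ _ clB nBa.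
    have f1 x : f x <= 1.
      by have := f01 _ (ex_intro2 _ _ x I erefl); rewrite /= in_itv /= => /andP[].
    have f_a : f a = 0 by exact: (fa _ (ex_intro2 _ _ a erefl erefl)).
    exists [set x | f x < 1 / 2].
      have := cf a; rewrite /continuous_at f_a => /cvgr_lt; apply.
      by rewrite divr_gt0.
    exists (fun x => 2 * (1 - f x)); split.
    + move=> x; apply: cvgM; first exact: cvg_cst.
      by apply: cvgB; [exact: cvg_cst|exact: cf].
    + by move=> x; rewrite mulr_ge0// subr_ge0.
    + by move=> x /= fx; lra.
    + by move=> x Bx; rewrite (_ : f x = 1) ?subrr ?mulr0//;
        exact: (fB _ (ex_intro2 _ _ x Bx erefl)).
move=> u [cu u0 uA uB]; exists (fun x => Num.min (u x) 1); split.
- move=> x; apply: (@continuous_min R X u (fun=> 1)); first exact: cu.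
  exact: cvg_cst.
- by move=> x; rewrite le_min u0 ler01 /= ge_min lexx orbT.
- by move=> x /uA ux; apply/min_idPr.
- by move=> x /uB ->; apply/min_idPl.
Qed.

(** The weights [1 / (n + 1)] tend to [0], so up to a given error only finitely
    many terms of the supremum matter: this is why it is continuous. *)
Lemma continuous_weighted_sup (R : realType) (X : topologicalType)
    (u : nat -> X -> R) :
  (forall n, continuous (u n)) -> (forall n x, 0 <= u n x <= 1) ->
  exists e : X -> R, [/\ continuous e, forall x, 0 <= e x,
    forall n x, u n x / n.+1%:R <= e x &
    forall x, (forall n, u n x = 0) -> e x = 0].
Proof.
move=> cu u01.
pose S x := range (fun n => u n x / n.+1%:R).
have S1 x : ubound (S x) 1.
  move=> _ [n _ <-]; have /andP[u0 u1] := u01 n x.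
  by rewrite ler_pdivrMr// mul1r (le_trans u1)// ler1n.
have supS x : has_sup (S x).
  by split; [exists (u 0 x / 1), 0|exists 1].
have leS n x : u n x / n.+1%:R <= sup (S x).
  by apply: (sup_upper_bound (supS x)); exists n.
exists (fun x => sup (S x)); split=> //; first last.
- move=> x ux; rewrite (_ : S x = [set 0]) ?sup1//.
  rewrite eqEsubset; split=> [_ [n _ <-]|_ ->] /=; first by rewrite ux mul0r.
  by exists 0 => //; rewrite ux mul0r.
- move=> x; apply: le_trans (leS 0 x).
  by rewrite divr1; have /andP[] := u01 0 x.
move=> x; apply/cvgrPdist_le => e e0.
have [N Ne] : exists N : nat, N.+1%:R^-1 < e.
  exists (Num.truncn e^-1); rewrite invf_plt ?posrE//.
  by rewrite Num.Theory.truncnS_gt.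
have near_lt : \forall y \near x, forall n, (n < N)%N -> `|u n x - u n y| <= e.
  elim: {Ne}N => [|N IH]; first by near=> y.
  have cN := (cu N x); move/cvgrPdist_le/(_ _ e0) : cN => cN.
  near=> y => n; rewrite ltnS leq_eqVlt => /orP[/eqP->|].
    by near: y.
  by move: n; near: y.
have bound y z : (forall n, (n < N)%N -> `|u n y - u n z| <= e) ->
    sup (S y) <= sup (S z) + e.
  move=> yz; apply: ge_sup; first by case: (supS y).
  move=> _ [n _ <-]; have [nN|Nn] := ltnP n N.
    have := yz _ nN; rewrite ler_norml => /andP[_].
    rewrite lerBlDr => ule.
    have := leS n z; set w := _ / _ => wS.
    apply: (@le_trans _ _ (w + e)); last by rewrite lerD2r.
    rewrite /w ler_pdivrMr// mulrDl divfK ?pnatr_eq0//.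
    have : e <= e * n.+1%:R by rewrite ler_peMr ?ler1n// ltW.
    by move: ule; lra.
  have /andP[_ u1] := u01 n y.
  have S0 : 0 <= sup (S z).
    by apply: le_trans (leS 0 z); rewrite divr1; have /andP[] := u01 0 z.
  rewrite -[_ / _]add0r lerD//; apply: le_trans (ltW Ne).
  rewrite -[leRHS]mul1r ler_pM// ?invr_ge0//; first by have /andP[] := u01 n y.
  by rewrite lef_pV2 ?posrE// ler_nat ltnS.
near=> y; rewrite ler_distl lerBlDr.
have xy : forall n, (n < N)%N -> `|u n x - u n y| <= e by near: y.
apply/andP; split; apply: bound => // n nN; rewrite distrC; exact: xy.
Unshelve. all: by end_near. Qed.

(** The distance to the complement is the required function. *)
Lemma open_positivity_set (R : realType) (Y : normedModType R) (O : set Y) :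
  open O -> exists u : Y -> R,
    [/\ continuous u, forall y, 0 <= u y & O = [set y | 0 < u y]].
Proof.
move=> oO.
have [->|/eqP nO] := eqVneq O setT.
  exists (fun=> 1); split; [by move=> y; exact: cvg_cst|by []|].
  by apply/seteqP; split=> // y _; exact: ltr01.
have [z0 Oz0] : exists z, ~ O z.
  apply: contrapT => /forallNP OT; apply: nO.
  by apply/seteqP; split=> // y _; apply: contrapT; exact: OT.
pose S y := [set `|y - z| | z in ~` O].
have infS y : has_inf (S y).
  by split; [exists `|y - z0|, z0|exists 0 => _ [z _ <-]].
have S0 y : 0 <= inf (S y).
  by apply: lb_le_inf; [case: (infS y)|move=> _ [z _ <-]].
exists (fun y => inf (S y)); split=> //.
  move=> x; apply/cvgrPdist_le => e e0.
  have bound y z : `|y - z| <= e -> inf (S y) <= inf (S z) + e.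
    move=> yz; rewrite -lerBlDr; apply: lb_le_inf; first by case: (infS z).
    move=> _ [t Ot <-]; rewrite lerBlDr.
    apply: (@le_trans _ _ `|y - t|).
      by apply: (ge_inf (infS y).2); exists t.
    by apply: (le_trans (ler_distD z y t)); rewrite addrC lerD2l.
  have near_le : \forall y \near x, `|x - y| <= e.
    have : (fun y : Y => y) @ x --> x by exact: cvg_id.
    by move/cvgrPdist_le => /(_ _ e0).
  near=> y; have xy : `|x - y| <= e by near: y.
  by rewrite ler_distl lerBlDr; apply/andP; split; apply: bound => //; rewrite distrC.
rewrite eqEsubset; split=> y /=.
  move=> Oy; have /nbhs_ballP[e/= e0 ye] := open_nbhs_nbhs (conj oO Oy).
  apply: (@lt_le_trans _ _ e) => //; apply: lb_le_inf; first by case: (infS y).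
  move=> _ [z Oz <-]; rewrite leNgt; apply/negP => yz; apply: Oz.
  by apply: ye; rewrite -ball_normE.
apply: contraPP => Oy; apply/negP; rewrite -leNgt.
by apply: (ge_inf (infS y).2); exists y => //; rewrite subrr normr0.
Unshelve. all: by end_near. Qed.

Lemma functionally_closed_zero_set (R : realType) (X : topologicalType) (K : set X) :
  functionally_closed R K -> exists d : X -> R,
    [/\ continuous d, forall x, 0 <= d x & K = [set x | d x = 0]].
Proof.
move=> [g [V [cg oV KV]]]; have [u [cu u0 Vu]] := open_positivity_set oV.
exists (u \o g); split; first 1 last.
- by move=> x; exact: u0.
- apply/seteqP; split=> x.
    move=> Kx; apply: contrapT => /eqP ux.
    suff : (~` K) x by [].
    by rewrite KV /preimage Vu /= lt_neqAle eq_sym ux u0.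
  move=> /= ux; apply: contrapT => nKx.
  have : (~` K) x by [].
  by rewrite KV /preimage Vu /= [u _]ux ltxx.
- by move=> x; apply: continuous_comp; [exact: cg|exact: cu].
Qed.

Lemma separate_sigma_compact_closed (R : realType) (X : topologicalType)
    (K C : set X) :
  completely_regular_space X -> sigma_compact K -> closed C ->
  (forall x, K x -> ~ C x) ->
  exists w : X -> R, [/\ continuous w, forall x, 0 <= w x,
    forall x, K x -> 0 < w x & forall x, C x -> w x = 0].
Proof.
move=> crX [F cF KF] clC KC.
have FC n x : F n x -> ~ C x by move=> Fx; apply: KC; rewrite KF; exists n.
have /choice[u uP] n := separate_compact_closed R crX (cF n) clC (@FC n).
have [||w [cw w0 uw wC]] := @continuous_weighted_sup R X u.
- by move=> n; have [] := uP n.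
- by move=> n; have [] := uP n.
exists w; split=> //.
  move=> x; rewrite KF => -[n _ Fx]; apply: lt_le_trans (uw n x).
  by have [_ _ -> //] := uP n; rewrite mul1r invr_gt0.
by move=> x Cx; apply: wC => n; have [_ _ _ ->] := uP n.
Qed.

(** [K] being both a zero set and covered by countably many compacts makes it
    functionally separated from each [C n]; the weighted supremum then collects
    these countably many separations into one function. *)
Lemma gauge_of_sigma_compact_zero_set (R : realType) (X : topologicalType)
    (K : set X) (C : nat -> set X) :
  completely_regular_space X -> sigma_compact K -> functionally_closed R K ->
  (forall n, closed (C n)) -> (forall n x, K x -> ~ C n x) ->
  exists e : X -> R, [/\ continuous e, forall x, 0 <= e x,
    K = [set x | e x = 0] & forall n x, C n x -> n.+1%:R^-1 <= e x].
Proof.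
move=> crX scK fcK clC KC.
have [d [cd d0 Kd]] := functionally_closed_zero_set fcK.
have /choice[w wP] n :=
  @separate_sigma_compact_closed R X K (C n) crX scK (clC n) (KC n).
have dw0 n x : 0 < d x + w n x.
  have [_ w0 wK _] := wP n; have [Kx|nKx] := pselect (K x).
    by rewrite ltr_wpDl// wK.
  rewrite ltr_pwDl// lt_neqAle d0 andbT eq_sym; apply/eqP => dx.
  by apply: nKx; rewrite Kd.
pose h n x := d x / (d x + w n x).
have h01 n x : 0 <= h n x <= 1.
  have [_ w0 _ _] := wP n.
  apply/andP; split; first by rewrite divr_ge0// ltW.
  by rewrite ler_pdivrMr// mul1r lerDl.
have [||e [ce e0 he eK]] := @continuous_weighted_sup R X h.
- move=> n x; have [cw _ _ _] := wP n; apply: cvgM; first exact: cd.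
  apply: cvgV; first by rewrite gt_eqF.
  by apply: cvgD; [exact: cd|exact: cw].
- exact: h01.
exists e; split=> //.
  rewrite Kd; apply/seteqP; split=> x /= => [dx|ex].
    by apply: eK => n; rewrite /h dx mul0r.
  apply/eqP; rewrite eq_le d0 andbT.
  have := he 0 x; rewrite ex divr1 => h0; move: h0.
  by rewrite [h _ _]/h ler_pdivrMr// mul0r.
move=> n x Cx; apply: le_trans (he n x).
have [_ _ _ wC] := wP n; have := dw0 n x; rewrite /h wC// addr0 => dx.
by rewrite divff ?gt_eqF// mul1r.
Qed.

(** Near each point only finitely many of the functions [F n] contribute, so the
    interpolation along the scale [1 / e] is continuous wherever [e > 0]. *)
Lemma interpolate_along_gauge (R : realType) (X : topologicalType)
    (Y : normedModType R) (e : X -> R) (F : nat -> X -> Y) :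
  continuous e -> (forall n, continuous (F n)) ->
  exists G : X -> Y,
    (forall x, 0 < e x -> {for x, continuous G}) /\
    forall x n, 0 < e x -> e x < n.+1%:R^-1 -> exists N, exists s : R,
      [/\ (n <= N)%N, e x <= N.+1%:R^-1, 0 <= s <= 1 &
          G x = F N x + s *: (F N.+1 x - F N x)].
Proof.
move=> ce cF.
(* The [n]-th increment is fully present once [1 / e x >= n + 2], and absent
   while [1 / e x <= n + 1]. *)
pose t n x : R := Num.max 0 (Num.min 1 ((e x)^-1 - n.+1%:R)).
pose S M x : Y := F 0 x + \sum_(n < M) t n x *: (F n.+1 x - F n x).
have S_stable M M' x : (M <= M')%N -> (e x)^-1 <= M.+1%:R -> S M' x = S M x.
  move=> MM' eM; rewrite /S; congr (_ + _).
  rewrite -(subnKC MM') big_split_ord /= [X in _ + X]big1 ?addr0// => i _.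
  rewrite /t /= (_ : Num.max 0 _ = 0) ?scale0r//; apply/max_idPl.
  rewrite ge_min subr_le0 (le_trans eM) ?orbT// ler_nat ltnS.
  exact: leq_addr.
pose G x := S (Num.truncn (e x)^-1) x.
have GS M x : (e x)^-1 <= M.+1%:R -> G x = S M x.
  move=> eM; rewrite /G; have [le|/ltnW le] := leqP (Num.truncn (e x)^-1) M.
    by rewrite (S_stable _ _ _ le)// ltW// Num.Theory.truncnS_gt.
  exact: S_stable.
exists G; split.
  move=> x ex.
  have cV : (e y)^-1 @[y --> x] --> (e x)^-1.
    by apply: cvgV; [rewrite gt_eqF|exact: ce].
  pose M := (Num.truncn (e x)^-1).
  have nearM : \forall y \near x, (e y)^-1 <= M.+1%:R.
    apply: filterS (cvgr_lt _ cV _ (Num.Theory.truncnS_gt _)).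
    by move=> y; exact: ltW.
  have cS : {for x, continuous (S M)}.
    apply: cvgD; first exact: cF.
    apply: cvg_big => [|n _]; first exact: add_continuous.
    apply: cvgZ.
      apply: (@continuous_max R X (fun=> 0)); first exact: cvg_cst.
      apply: (@continuous_min R X (fun=> 1)); first exact: cvg_cst.
      by apply: cvgB => //; exact: cvg_cst.
    by apply: cvgB; exact: cF.
  suff : G y @[y --> x] --> S M x.
    by rewrite -GS//; exact: (nbhs_singleton nearM).
  apply: cvg_trans cS; apply: near_eq_cvg.
  by apply: filterS nearM => y eM; rewrite /= (GS M).
move=> x n ex exn.
have nex : n.+1%:R < (e x)^-1 by rewrite invf_pgt ?posrE.
pose N := (Num.truncn (e x)^-1).-1.
have /andP[N1 N2] : N.+1%:R <= (e x)^-1 < N.+2%:R.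
  rewrite /N prednK; last by rewrite truncn_gt0 (le_trans _ (ltW nex))// ler1n.
  by apply: truncn_itv; rewrite ltW// invr_gt0.
exists N, (t N x); split.
- have : n.+1%:R < N.+2%:R :> R by exact: lt_trans N2.
  by rewrite ltr_nat.
- by rewrite invf_pge ?posrE.
- by rewrite /t le_max lexx/= ge_max ler01 ge_min lexx.
rewrite (GS N.+1 x (ltW N2)) /S big_ord_recr /= addrA; congr (_ + _).
rewrite (eq_bigr (fun i : 'I_N => F i.+1 x - F i x)).
  rewrite -(big_mkord xpredT (fun i => F i.+1 x - F i x)) telescope_sumr//.
  by rewrite addrC subrK.
move=> i _; rewrite /t (_ : Num.min 1 _ = 1) ?(max_idPr _) ?scale1r//.
apply/min_idPl; by rewrite lerBrDr (le_trans _ N1)// nat1r ler_nat ltnS.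
Qed.

(** * Disjoint families with sigma-compact unions *)

Lemma countable_setU (T : Type) (A B : set T) :
  countable A -> countable B -> countable (A `|` B).
Proof.
move=> cA cB; rewrite -bigcup2E; apply: bigcup_countable => // -[|[|i]] _ //=.
Qed.

Lemma sub_countable_set (T : Type) (A B : set T) :
  A `<=` B -> countable B -> countable A.
Proof. by move=> AB; apply: sub_countable; exact: subset_card_le. Qed.

(** Pair the points of [A] off by a maximal family of disjoint two-point
    subsets: at most one point of [A] is left over, so that choosing one point of
    every pair, or the other one, gives two equipotent halves. *)
Lemma uncountable_split (T : Type) (A : set T) :
  ~ countable A -> exists A0 A1 : set T,
    [/\ forall x, A0 x -> ~ A1 x, A0 `<=` A, A1 `<=` A,
        ~ countable A0 & ~ countable A1].
Proof.
move=> unA.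
pose F (p : T * T) := [set p.1; p.2].
pose D := [set p : T * T | [/\ A p.1, A p.2 & p.1 <> p.2]].
have [E [ED tE maxE]] := ex_maximal_disjoint_subcollection F D.
have meet p q : E p -> E q -> forall x, F p x -> F q x -> p = q.
  by move=> Ep Eq x px qx; apply: tE => //; exists x.
have fst_inj : {in E &, injective fst}.
  move=> p q /set_mem Ep /set_mem Eq pq; apply: (meet _ _ Ep Eq p.1).
    by left.
  by left.
have snd_inj : {in E &, injective snd}.
  move=> p q /set_mem Ep /set_mem Eq pq; apply: (meet _ _ Ep Eq p.2).
    by right.
  by right.
have unE : ~ countable E.
  move=> cE; apply: unA.
  pose U := fst @` E `|` snd @` E.
  have cU : countable U.
    apply: countable_setU; apply: sub_countable cE; exact: card_image_le.
  have left_over a b : A a -> A b -> ~ U a -> ~ U b -> a = b.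
    move=> Aa Ab nUa nUb; apply: contrapT => ab.
    have nEF x : ~ U x -> forall p, E p -> ~ F p x.
      by move=> nUx p Ep [] /= xp; apply: nUx; [left|right]; exists p.
    apply: (maxE (E `|` [set (a, b)])).
    - split=> [p Ep|sub]; first by left.
      have /(nEF _ nUa) : E (a, b) by apply: sub; right.
      by apply; left.
    - by move=> p [/ED//|->].
    - move=> p q [Ep|->] [Eq|->] // [x [px qx]]; first exact: (meet _ _ Ep Eq x).
        by move: qx px => [] /= -> /nEF; [move=> /(_ nUa)|move=> /(_ nUb)].
      by move: px qx => [] /= -> /nEF; [move=> /(_ nUa)|move=> /(_ nUb)].
  have [[a [Aa nUa]]|none] := pselect (exists a, A a /\ ~ U a).
    apply: (@sub_countable_set _ _ (U `|` [set a])).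
      move=> x Ax; have [Ux|nUx] := pselect (U x); first by left.
      by right; exact: left_over.
    by apply: countable_setU => //; exact: countable1.
  apply: sub_countable_set cU => x Ax; apply: contrapT => nUx.
  by apply: none; exists x.
exists (fst @` E), (snd @` E); split.
- move=> _ [p Ep <-] [q Eq qp].
  have pq : p = q by apply: (meet _ _ Ep Eq p.1); [left|right].
  by have [_ _] := ED _ Ep; apply; rewrite -qp pq.
- by move=> _ [p /ED[? _ _] <-].
- by move=> _ [p /ED[_ ? _] <-].
- by rewrite (eq_countable (inj_card_eq fst_inj)).
- by rewrite (eq_countable (inj_card_eq snd_inj)).
Qed.

Lemma nested_compact_nonempty (X : topologicalType) (L : nat -> set X) :
  hausdorff_space X -> (forall n, compact (L n)) ->
  (forall n, L n.+1 `<=` L n) -> (forall n, L n !=set0) ->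
  exists x, forall n, L n x.
Proof.
move=> hX cL dL L0.
have mono m n : (m <= n)%N -> L n `<=` L m.
  elim: n => [|n IH]; first by rewrite leqn0 => /eqP ->.
  rewrite leq_eqVlt => /orP[/eqP->//|]; rewrite ltnS => /IH.
  exact: subset_trans (dL n).
pose G := filter_from setT L.
have FG : ProperFilter G.
  apply: filter_from_proper; last by move=> n _; exact: L0.
  apply: filter_from_filter; first by exists 0.
  move=> i j _ _; exists (maxn i j) => // x Lx.
  by split; apply: mono Lx; rewrite ?leq_maxl ?leq_maxr.
have [|x [_ xG]] := cL 0 G FG; first by exists 0.
exists x => n; apply: (compact_closed hX (cL n)) => V xV.
by apply: xG => //; exists n.
Qed.

(** The most recent bit comes first, so that extending a branch is [cons]. *)
Fixpoint prefix_of (r : nat -> bool) (k : nat) : seq bool :=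
  if k is k'.+1 then r k' :: prefix_of r k' else [::].

(** If uncountably many members were nonempty, halving the uncountable index set
    again and again would give a binary tree of compact sets such that no member
    of the family meets two incomparable nodes. Given a set [S] of branches, the
    union of the members having a point on a branch in [S] is a union of compact
    sets [Q n], so a branch is in [S] exactly when all its nodes meet some
    [Q n]. Thus [S] is coded by the relation between nodes and [n] telling which
    of them meet, which is itself a branch up to an enumeration: the diagonal set
    of branches has no code. *)
Lemma countable_compact_additive_family (X : topologicalType) (I : Type)
    (A : I -> set X) :
  hausdorff_space X -> trivIset setT A ->
  (forall T : set I, sigma_compact (\bigcup_(i in T) A i)) ->
  countable [set i | A i !=set0].
Proof.
move=> hX tA scA; apply: contrapT => unA.
pose idx (L : set X) := [set i | A i `&` L !=set0].
pose big (L : set X) := [/\ compact L, L `<=` \bigcup_i A i & ~ countable (idx L)].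
have meet i j x : A i x -> A j x -> i = j.
  by move=> Aix Ajx; apply: tA => //; exists x.
(* An uncountable set of indices met by [L] survives on one compact piece. *)
have big_in (T : set I) : ~ countable T ->
    (forall i, T i -> A i !=set0) -> forall L, compact L ->
    (forall i, T i -> A i `&` L !=set0) ->
    exists L', [/\ big L', L' `<=` L & L' `<=` \bigcup_(i in T) A i].
  move=> unT _ L cL TL; have [P cP PT] := scA T.
  apply: contrapT => none; apply: unT.
  apply: (@sub_countable_set _ _ (\bigcup_n idx (L `&` P n))).
    move=> i Ti; have [x [Aix Lx]] := TL i Ti.
    have [n _ Pnx] : (\bigcup_n P n) x by rewrite -PT; exists i.
    by exists n => //; exists x.
  apply: bigcup_countable => // n _; apply: contrapT => unL; apply: none.
  exists (L `&` P n); split=> [|x []//|x [_ Pnx]].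
    split=> //.
      by rewrite setIC; apply: compact_closedI (compact_closed hX cL).
    move=> x [_ Pnx]; have : (\bigcup_n P n) x by exists n.
    by rewrite -PT => -[i _ Aix]; exists i.
  by rewrite PT; exists n.
have split_big (L : {L | big L}) : exists L' : {L | big L} * {L | big L},
    [/\ projT1 L'.1 `<=` projT1 L, projT1 L'.2 `<=` projT1 L &
    forall i, idx (projT1 L'.1) i -> ~ idx (projT1 L'.2) i].
  case: L => L [cL LA unL] /=.
  have [T0 [T1 [T01 T0L T1L unT0 unT1]]] := uncountable_split unL.
  have [|L0 [bL0 L0L L0T]] := big_in _ unT0 _ _ cL T0L.
    by move=> i /T0L[x [Aix _]]; exists x.
  have [|L1 [bL1 L1L L1T]] := big_in _ unT1 _ _ cL T1L.
    by move=> i /T1L[x [Aix _]]; exists x.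
  exists (exist _ L0 bL0, exist _ L1 bL1); split=> //= i.
  move=> [x [Aix /L0T[j T0j Ajx]]] [y [Aiy /L1T[k T1k Aky]]].
  apply: (T01 i); first by rewrite (meet i j x).
  by rewrite (meet i k y).
have /choice[sp spP] := split_big.
have [L0 bL0] : exists L, big L.
  have [P cP PT] := scA setT.
  apply: contrapT => none; apply: unA.
  apply: (@sub_countable_set _ _ (\bigcup_n idx (P n))).
    move=> i [x Aix].
    have [n _ Pnx] : (\bigcup_n P n) x by rewrite -PT; exists i.
    by exists n => //; exists x.
  apply: bigcup_countable => // n _; apply: contrapT => unL; apply: none.
  exists (P n); split=> // x Pnx.
  by rewrite PT; exists n.
pose node := fix node (s : seq bool) : {L | big L} :=
  if s is b :: s' then (if b then (sp (node s')).2 else (sp (node s')).1)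
  else exist _ L0 bL0.
pose L s := projT1 (node s).
have bL s : big (L s) by exact: (projT2 (node s)).
have cL s : compact (L s) by have [] := bL s.
have LS b s : L (b :: s) `<=` L s.
  by rewrite /L /=; have [] := spP (node s); case: b.
have Lsplit b b' s i : idx (L (b :: s)) i -> idx (L (b' :: s)) i -> b = b'.
  rewrite /L /=; have [_ _ h] := spP (node s).
  by case: b b' => -[] //= i1 i2; [case: (h i i2 i1)|case: (h i i1 i2)].
have Lbranch r r' i x x' : A i x -> A i x' -> (forall k, L (prefix_of r k) x) ->
    (forall k, L (prefix_of r' k) x') -> r = r'.
  move=> Aix Aix' rx rx'.
  have pre k : prefix_of r k = prefix_of r' k.
    elim: k => //= k IH; congr (_ :: _) => //.
    apply: (Lsplit _ _ (prefix_of r k) i).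
      by exists x; split=> //; exact: (rx k.+1).
    by rewrite IH; exists x'; split=> //; exact: (rx' k.+1).
  by apply/funext => k; have [] := pre k.+1.
have closed_branch r (Q : set X) : compact Q ->
    (forall k, L (prefix_of r k) `&` Q !=set0) ->
    exists x, Q x /\ forall k, L (prefix_of r k) x.
  move=> cQ LQ.
  have [|||x xP] := @nested_compact_nonempty X (fun k => L (prefix_of r k) `&` Q) hX.
  - by move=> k; apply: compact_closedI (compact_closed hX cQ).
  - by move=> k; apply: setSI; exact: LS.
  - exact: LQ.
  by exists x; split=> [|k]; [have [] := xP 0|have [] := xP k].
(* [S] is diagonal: [r] is read as a code, applied to its own branch. *)
pose S (r : nat -> bool) := ~ exists n : nat, forall k, r (pickle (n, prefix_of r k)).
pose T := [set i | exists r, S r /\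
  exists x, A i x /\ forall k, L (prefix_of r k) x].
have [Q cQ QT] := scA T.
pose r0 (m : nat) : bool :=
  if (unpickle m : option (nat * seq bool)) is Some (n, s) then
    `[< L s `&` Q n !=set0 >]
  else false.
have r0E n s : r0 (pickle (n, s)) = `[< L s `&` Q n !=set0 >].
  by rewrite /r0 pickleK.
have [[n rn]|Sr0] := pselect (exists n : nat, forall k, r0 (pickle (n, prefix_of r0 k))).
  have [|x [Qx xP]] := @closed_branch r0 (Q n) (cQ n).
    by move=> k; have := rn k; rewrite r0E => /asboolP.
  have : (\bigcup_n Q n) x by exists n.
  rewrite -QT => -[i [r [Sr [x' [Aix' rx']]]] Aix].
  by apply: Sr; rewrite (Lbranch _ _ _ _ _ Aix' Aix rx' xP); exists n.
have [|x [_ xP]] := @closed_branch r0 (L [::]) (cL _).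
  move=> k; have [_ LA unL] := bL (prefix_of r0 k).
  have [y Ly] : L (prefix_of r0 k) !=set0.
    apply/set0P/eqP => L_0; apply: unL; rewrite L_0.
    rewrite (_ : idx set0 = set0) ?countable0//.
    by apply/seteqP; split=> // i [z []].
  exists y; split=> //; elim: k {LA unL} Ly => //= k IH /LS; exact: IH.
have [i _ Aix] : (\bigcup_i A i) x.
  by have [_ + _] := bL (prefix_of r0 0); apply; exact: xP.
have [n _ Qnx] : (\bigcup_n Q n) x.
  by rewrite -QT; exists i => //; exists r0; split=> //; exists x.
by apply: Sr0; exists n => k; rewrite r0E; apply/asboolP; exists x.
Qed.

(** * F-sigma measurable functions as limits of continuous functions *)

Lemma bigcup_pickle (T : Type) (A : nat -> nat -> set T) :
  \bigcup_n \bigcup_m A n m =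
  \bigcup_k (if (unpickle k : option (nat * nat)) is Some (n, m) then A n m else set0).
Proof.
apply/seteqP; split=> x.
  by move=> [n _ [m _ Ax]]; exists (pickle (n, m)) => //; rewrite pickleK.
move=> [k _]; case: (unpickle k : option (nat * nat)) => // -[n m] Ax.
by exists n => //; exists m.
Qed.

Lemma sigma_compact_Fsigma (X : topologicalType) (K B : set X) :
  hausdorff_space X -> sigma_compact K -> Fsigma B -> B `<=` K ->
  sigma_compact B.
Proof.
move=> hX [F cF KF] [C cC BC] BK.
exists (fun k => if (unpickle k : option (nat * nat)) is Some (n, m)
  then F n `&` C m else set0).
  move=> k; case: (unpickle k : option (nat * nat)) => [[n m]|].
    by apply: subclosed_compact (cF n) _ => //; apply: closedI => //;
      exact: compact_closed.
  exact: compact0.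
rewrite -(bigcup_pickle (fun n m => F n `&` C m)).
apply/seteqP; split=> x.
  move=> Bx; have := BK _ Bx; rewrite KF => -[n _ Fx].
  by move: Bx; rewrite BC => -[m _ Cx]; exists n => //; exists m.
by move=> [n _ [m _ [_ Cx]]]; rewrite BC; exists m.
Qed.

Lemma countable_range (T : Type) (t0 : T) (D : set T) :
  countable D -> exists c : nat -> T, forall a, D a -> exists n, c n = a.
Proof.
move=> /countable_injP[g gI].
have /choice[c cP] n : exists a, (exists2 b, D b & g b = n) -> D a /\ g a = n.
  have [[b Db gb]|nb] := pselect (exists2 b, D b & g b = n); first by exists b.
  by exists t0.
exists c => a Da; exists (g a); have [|Dc gc] := cP (g a); first by exists a.
by apply: gI => //; exact/mem_set.
Qed.

Section Approximation.
Variables (R : realType) (X : topologicalType) (Y : normedModType R).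
Variables (K : set X) (f : X -> Y).
Hypothesis hX : hausdorff_space X.
Hypothesis crX : completely_regular_space X.
Hypothesis scK : sigma_compact K.
Hypothesis hf : forall O : set Y, open O -> Fsigma (K `&` f @^-1` O).

(** A maximal family of disjoint balls centred in the range gives the net. It is
    countable because unions of balls are open, so that the preimages form a
    disjoint family with sigma-compact unions. *)
Lemma Fsigma_measurable_countable_net (eps : R) : 0 < eps ->
  exists c : nat -> Y, forall x, K x -> exists n, `|f x - c n| < eps.
Proof.
move=> e0.
have [S [SK tS maxS]] :=
  ex_maximal_disjoint_subcollection (fun y : Y => ball y (eps / 2)) (f @` K).
pose A y := [set x | S y /\ (K `&` f @^-1` ball y (eps / 2)) x].
have cS : countable S.
  apply: (@sub_countable_set _ _ [set y | A y !=set0]).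
    move=> y Sy; have [x Kx fx] := SK _ Sy; exists x; split=> //; split=> //=.
    by rewrite fx; apply: ballxx; rewrite divr_gt0.
  apply: countable_compact_additive_family => //.
    move=> y z _ _ [x [[Sy [_ yx]] [Sz [_ zx]]]].
    by apply: tS => //; exists (f x).
  move=> T; apply: sigma_compact_Fsigma scK _ _ => //; last first.
    by move=> x [y _ [_ []]].
  rewrite (_ : \bigcup_(i in T) A i =
      K `&` f @^-1` (\bigcup_(y in T `&` S) ball y (eps / 2))).
    by apply: hf; apply: bigcup_open => y _; exact: ball_open.
  apply/seteqP; split=> x.
    by move=> [y Ty [Sy [Kx yx]]]; split=> //; exists y.
  by move=> [Kx [y [Ty Sy] yx]]; exists y.
have [c cP] := countable_range 0 cS.
exists c => x Kx.
have [y [Sy [z [yz fz]]]] : exists y, S y /\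
    (ball y (eps / 2) `&` ball (f x) (eps / 2)) !=set0.
  apply: contrapT => none.
  have nSx : ~ S (f x).
    move=> Sx; apply: none; exists (f x); split=> //; exists (f x).
    by split; apply: ballxx; rewrite divr_gt0.
  apply: (maxS (S `|` [set f x])).
  - by split=> [y Sy|sub]; [left|apply: nSx; apply: sub; right].
  - by move=> y [/SK//|->]; exists x.
  - move=> y z [Sy|->] [Sz|->] // yz; first exact: tS.
      by exfalso; apply: none; exists y.
    by exfalso; apply: none; exists z; split=> //; rewrite setIC.
have [n cn] := cP _ Sy; exists n; rewrite cn distrC.
by have := ball_triangle yz (ball_sym fz); rewrite -splitr -ball_normE.
Qed.

(** Write [O] as the set where [u] is positive. The points of [K] where
    [u (f x)] exceeds [1 / (m + 1)] and those where it is below are disjoint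
    sigma-compact sets, so each compact piece of the former lies in a zero set
    missing the latter. This trades the closed sets of an F-sigma decomposition
    for zero sets, whose defining functions can be used as weights. *)
Lemma Fsigma_measurable_zero_sets (O : set Y) : open O ->
  exists w : nat -> X -> R, [/\ forall n, continuous (w n),
    forall n x, 0 <= w n x &
    forall x, K x -> O (f x) <-> exists n, w n x = 0].
Proof.
move=> /(@open_positivity_set R)[u [cu u0 Ou]].
have oV m : open [set y | m.+1%:R^-1 < u y].
  by apply: (open_comp (f := u)) (@open_gt _ _) => y _; exact: cu.
have oB m : open [set y | u y < m.+1%:R^-1].
  by apply: (open_comp (f := u)) (@open_lt _ _) => y _; exact: cu.
have sc V : open V -> sigma_compact (K `&` f @^-1` V).
  by move=> /hf FV; apply: sigma_compact_Fsigma scK FV _ => // x [].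
have /choice[A AP] m : exists A : nat -> set X, (forall n, compact (A n)) /\
    K `&` f @^-1` [set y | m.+1%:R^-1 < u y] = \bigcup_n A n.
  by have [A cA AE] := sc _ (oV m); exists A.
have AK m n x : A m n x -> m.+1%:R^-1 < u (f x).
  move=> Ax; have [_ /seteqP[_ AE]] := AP m.
  by have [|] := AE x; first by exists n.
have wP (p : nat * nat) : exists w : X -> R, [/\ continuous w,
    forall x, 0 <= w x, forall x, K x -> w x = 0 -> O (f x) &
    forall x, A p.1 p.2 x -> w x = 0].
  case: p => m n /=; have [cA _] := AP m.
  have [|w [cw w0 wB wA]] := @separate_sigma_compact_closed R X _ (A m n) crX
      (sc _ (oB m)) (compact_closed hX (cA n)).
    by move=> x [_ /= ub] /AK /lt_trans /(_ ub); rewrite ltxx.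
  exists w; split=> // x Kx wx; rewrite Ou /=.
  apply: contrapT => /negP; rewrite -leNgt => ux.
  suff : 0 < w x by rewrite wx ltxx.
  by apply: wB; split=> //=; apply: le_lt_trans ux _; rewrite invr_gt0.
have {wP} /choice[w wP] := wP.
exists (fun k => if (unpickle k : option (nat * nat)) is Some p then w p
  else fun=> 1); split.
- move=> k; case: (unpickle k : option (nat * nat)) => [p|].
    by have [] := wP p.
  by move=> x; exact: cvg_cst.
- move=> k x; case: (unpickle k : option (nat * nat)) => [p|//].
  by have [_ + _ _] := wP p; apply.
move=> x Kx; split=> [|[k]].
  rewrite Ou /= => ux; pose m := Num.truncn (u (f x))^-1.
  have mu : m.+1%:R^-1 < u (f x).
    by rewrite invf_plt ?posrE// Num.Theory.truncnS_gt.
  have [_ /seteqP[/(_ x) AE _]] := AP m; have [//|n _ Ax] := AE.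
  by exists (pickle (m, n)); rewrite pickleK; have [_ _ _ ->] := wP (m, n).
case: (unpickle k : option (nat * nat)) => [p|/eqP]; last by rewrite oner_eq0.
by have [_ _ + _] := wP p; apply.
Qed.

Lemma Fsigma_measurable_zero_set_net (eps : R) : 0 < eps ->
  exists (w : nat -> X -> R) (c : nat -> Y), [/\ forall k, continuous (w k),
    forall k x, 0 <= w k x, forall x, K x -> exists k, w k x = 0 &
    forall x k, K x -> w k x = 0 -> `|f x - c k| < eps].
Proof.
move=> e0; have [c cP] := Fsigma_measurable_countable_net e0.
have /choice[w wP] n :=
  @Fsigma_measurable_zero_sets (ball (c n) eps) (ball_open _ _).
exists (fun k => if (unpickle k : option (nat * nat)) is Some (n, m) then w n m
  else fun=> 1), (fun k => if (unpickle k : option (nat * nat)) is Some (n, m)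
  then c n else 0); split.
- move=> k; case: (unpickle k : option (nat * nat)) => [[n m]|].
    by have [+ _ _] := wP n; apply.
  by move=> x; exact: cvg_cst.
- move=> k x; case: (unpickle k : option (nat * nat)) => [[n m]|//].
  by have [_ + _] := wP n; apply.
- move=> x Kx; have [n xn] := cP x Kx; have [_ _ /(_ x Kx)[+ _]] := wP n.
  rewrite -ball_normE /= distrC => /(_ xn)[m wx].
  by exists (pickle (n, m)); rewrite pickleK.
- move=> x k Kx; case: (unpickle k : option (nat * nat)) => [[n m]|/eqP].
    have [_ _ /(_ x Kx)[_ +]] := wP n => + wx; rewrite distrC.
    by rewrite -ball_normE; apply; exists m.
  by rewrite oner_eq0.
Qed.

End Approximation.

(** At step [n] the value [c k] is blended in where [w k < 1 / n], the smaller
    indices being applied last so that they prevail. At a given point, with [l]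
    the first zero of [w ^~ x], the values of index below [l] are no longer
    blended in for large [n], and [c l] overrides the rest. *)
Lemma priority_blend (R : realType) (X : topologicalType) (Y : normedModType R)
    (w : nat -> X -> R) (c : nat -> Y) :
  (forall k, continuous (w k)) -> (forall k x, 0 <= w k x) ->
  exists H : nat -> X -> Y, (forall n, continuous (H n)) /\
    forall x, (exists k, w k x = 0) ->
      exists2 l, w l x = 0 & \forall n \near \oo, H n x = c l.
Proof.
move=> cw w0.
pose phi n k x : R := Num.max 0 (1 - n%:R * w k x).
pose blend n := fix blend (s : seq nat) (x : X) : Y :=
  if s is k :: s' then blend s' x + phi n k x *: (c k - blend s' x) else 0.
have blend0 n s1 s2 x : (forall k, k \in s1 -> phi n k x = 0) ->
    blend n (s1 ++ s2) x = blend n s2 x.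
  elim: s1 => //= k s1 IH phi0; rewrite phi0 ?mem_head// scale0r addr0 IH//.
  by move=> j js; apply: phi0; rewrite in_cons js orbT.
exists (fun n => blend n (iota 0 n)); split.
  move=> n x; elim: (iota 0 n) => [|k s IH]; first exact: cvg_cst.
  apply: cvgD; first exact: IH.
  apply: cvgZ; last by apply: cvgB; [exact: cvg_cst|exact: IH].
  apply: (@continuous_max R X (fun=> 0)); first exact: cvg_cst.
  apply: cvgB; first exact: cvg_cst.
  by apply: cvgM; [exact: cvg_cst|exact: cw].
move=> x [k /eqP wk].
have exk : exists k, w k x == 0 by exists k.
case: (ex_minnP exk) => l /eqP wl lmin; exists l => //.
have phi0 : \forall n \near \oo, forall j, (j < l)%N -> phi n j x = 0.
  have wpos j : (j < l)%N -> 0 < w j x.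
    move=> jl; rewrite lt_neqAle w0 andbT eq_sym; apply: contraTN jl => /lmin.
    by rewrite leqNgt.
  elim: (l) wpos => [|m IH] wpos; first by near=> n.
  have phim : \forall n \near \oo, phi n m x = 0.
    have wm := wpos m (ltnSn m).
    exists (Num.truncn (w m x)^-1).+1 => //= n mn; apply/max_idPl.
    rewrite subr_le0 -ler_pdivrMr// mul1r ltW//.
    by rewrite (lt_le_trans (Num.Theory.truncnS_gt _))// ler_nat.
  have phij : \forall n \near \oo, forall j, (j < m)%N -> phi n j x = 0.
    by apply: IH => j jm; apply: wpos; rewrite ltnS ltnW.
  near=> n => j; rewrite ltnS leq_eqVlt => /orP[/eqP->|]; first by near: n.
  by move: j; near: n.
near=> n.
have ln : (l < n)%N by near: n; exists l.+1.
have phil : forall j, (j < l)%N -> phi n j x = 0 by near: n.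
have -> : iota 0 n = iota 0 l ++ l :: iota l.+1 (n - l.+1).
  by rewrite -[in LHS](subnKC ln) addSnnS iotaD.
rewrite blend0; last first.
  by move=> j; rewrite mem_iota add0n => /andP[_]; exact: phil.
have phi1 : phi n l x = 1 by rewrite /phi wl mulr0 subr0 (max_idPr ler01).
by rewrite /= phi1 scale1r addrC subrK.
Unshelve. all: by end_near. Qed.

Definition radial_truncation (R : realType) (Y : normedModType R) (r : R) (v : Y) : Y :=
  (r / Num.max r `|v|) *: v.

Section RadialTruncation.
Variables (R : realType) (Y : normedModType R) (r : R).
Hypothesis r0 : 0 < r.

Let max_gt0 (v : Y) : 0 < Num.max r `|v|.
Proof. by rewrite lt_max r0. Qed.

Lemma continuous_radial_truncation : continuous (@radial_truncation R Y r).
Proof.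
move=> v; apply: cvgZ; last exact: cvg_id.
apply: cvgM; first exact: cvg_cst.
apply: cvgV; first by rewrite gt_eqF.
apply: (@continuous_max R Y (fun=> r)); first exact: cvg_cst.
exact: norm_continuous.
Qed.

Lemma norm_radial_truncation (v : Y) : `|radial_truncation r v| <= r.
Proof.
rewrite /radial_truncation normrZ ger0_norm; last by rewrite divr_ge0// ltW.
rewrite mulrAC ler_pdivrMr//; apply: ler_wpM2l; first exact: ltW.
by rewrite le_max lexx orbT.
Qed.

Lemma radial_truncation_id (v : Y) : `|v| <= r -> radial_truncation r v = v.
Proof.
move=> vr; rewrite /radial_truncation (max_idPl vr) divff ?scale1r//.
by rewrite gt_eqF.
Qed.

End RadialTruncation.

Section BaireOne.
Variables (R : realType) (X : topologicalType) (Y : normedModType R).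
Variables (K : set X) (f : X -> Y).
Hypothesis hX : hausdorff_space X.
Hypothesis crX : completely_regular_space X.
Hypothesis scK : sigma_compact K.
Hypothesis hf : forall O : set Y, open O -> Fsigma (K `&` f @^-1` O).

Lemma Fsigma_measurable_eventual_approx (eps : R) : 0 < eps ->
  exists (H : nat -> X -> Y) (g : X -> Y), (forall n, continuous (H n)) /\
    forall x, K x -> `|f x - g x| < eps /\ \forall n \near \oo, H n x = g x.
Proof.
move=> e0.
have [w [c [cw w0 wK wc]]] :=
  Fsigma_measurable_zero_set_net hX crX scK hf e0.
have [H [cH HP]] := priority_blend c cw w0.
have /choice[g gP] x : exists y, K x ->
    `|f x - y| < eps /\ \forall n \near \oo, H n x = y.
  have [Kx|nKx] := pselect (K x); last by exists 0.
  by have [l wl Hl] := HP x (wK x Kx); exists (c l) => _; split=> //; exact: wc.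
by exists H, g.
Qed.

(** The approximations of precision [2 ^- m] are eventually constant at each point
    of [K], so truncating the difference of two successive ones at
    [3 * 2 ^- (m + 1)] does not affect their limits. It makes the sequence of
    scales uniformly Cauchy, and the diagonal sequence converges to [f]. *)
Lemma Fsigma_measurable_pointwise_limit :
  exists F : nat -> X -> Y, (forall n, continuous (F n)) /\
    forall x, K x -> F n x @[n --> \oo] --> f x.
Proof.
pose eps m : R := 2^-1 ^+ m.
have eps_gt0 m : 0 < eps m by rewrite exprn_gt0.
have epsS m : eps m = 2 * eps m.+1 by rewrite /eps exprS mulrA divff ?mul1r.
have /choice[H HP] m := Fsigma_measurable_eventual_approx (eps_gt0 m).
have {HP} /choice[g HP] := HP.
pose G := fix G m n x : Y := if m is m'.+1
  then G m' n x + radial_truncation (3 * eps m) (H m n x - G m' n x)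
  else H 0 n x.
have cG m n : continuous (G m n).
  elim: m => [|m IH]; first by have [+ _] := HP 0; apply.
  move=> x; apply: cvgD; first exact: IH.
  apply: (@continuous_comp X Y Y (fun x => H m.+1 n x - G m n x)).
    apply: cvgB; last exact: IH.
    by have [+ _] := HP m.+1; apply.
  by apply: continuous_radial_truncation; rewrite mulr_gt0.
have Gg m x : K x -> \forall n \near \oo, G m n x = g m x.
  move=> Kx; elim: m => [|m IH].
    by have [_ /(_ x Kx)[]] := HP 0.
  have [_ /(_ x Kx)[fm _]] := HP m.
  have [_ /(_ x Kx)[fm1 Hm1]] := HP m.+1.
  near=> n => /=.
  have -> : H m.+1 n x = g m.+1 x by near: n.
  have -> : G m n x = g m x by near: n.
  rewrite radial_truncation_id ?mulr_gt0//; first by rewrite addrC subrK.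
  apply: le_trans (ler_distD (f x) _ _) _.
  by move: fm fm1; rewrite (distrC _ (f x)) (epsS m); lra.
have Gdist m p n x : `|G (m + p)%N n x - G m n x| <= 3 * (eps m - eps (m + p)%N).
  elim: p => [|p IH]; first by rewrite addn0 !subrr normr0 mulr0.
  have r0 : 0 < 3 * eps (m + p).+1%N by rewrite mulr_gt0.
  rewrite addnS /=; have := norm_radial_truncation r0
    (H (m + p).+1%N n x - G (m + p)%N n x).
  set t := radial_truncation _ _ => tr.
  rewrite addrAC; apply: le_trans (ler_normD _ _) _.
  by move: IH tr (epsS (m + p)%N); lra.
exists (fun n => G n n); split; first by move=> n; exact: cG.
move=> x Kx; apply/cvgrPdist_lt => e e0.
have [m me] : exists m, 4 * eps m < e.
  have half1 : `|2^-1 : R| < 1 by rewrite ger0_norm// invf_lt1// ltr1n.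
  have [m _ /(_ m (leqnn m)) /= me] := cvgr_lt _ (cvg_geometric 4 half1) _ e0.
  by exists m.
have [_ /(_ x Kx)[fm _]] := HP m.
have Gm := Gg m x Kx.
near=> n.
have mn : (m <= n)%N by near: n; exists m.
have Gn : G m n x = g m x by near: n.
have := Gdist m (n - m)%N n x; rewrite subnKC// Gn => Gd.
apply: le_lt_trans me.
apply: le_trans (ler_distD (g m x) _ _) _.
by move: Gd fm (eps_gt0 n); rewrite (distrC (G n n x)); lra.
Unshelve. all: by end_near. Qed.

End BaireOne.

(** * Transfer of F-sigma sets and gluing *)

Lemma Fsigma_image_set_val (X : topologicalType) (K : set X) (B : set K) :
  closed K -> Fsigma B -> Fsigma (set_val @` B).
Proof.
move=> clK [C clC BC].
have /choice[C' C'P] n : exists C' : set X,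
    closed C' /\ C n = [set x : K | C' (set_val x)].
  have [W oW WC] : exists2 W : set X, open W & set_val @^-1` W = ~` C n.
    by have := clC n; rewrite -openC => -[W oW WC]; exists W.
  exists (~` W); split; first exact: open_closedC.
  by rewrite -[LHS]setCK -WC.
exists (fun n => K `&` C' n); first by move=> n; apply: closedI; have [] := C'P n.
apply/seteqP; split=> x.
  move=> [y By <-]; move: By; rewrite BC => -[n _ Cy]; exists n => //; split.
    exact: set_valP.
  by move: Cy; have [_ ->] := C'P n.
move=> [n _ [Kx Cx]]; exists (SigSub (mem_set Kx)) => //.
by rewrite BC; exists n => //; have [_ ->] := C'P n.
Qed.

Lemma functionally_open_open (R : realType) (X : topologicalType) (O : set X) :
  functionally_open R O -> open O.
Proof.
by move=> [g [V [cg oV ->]]]; apply: open_comp oV => x _; exact: cg.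
Qed.

Lemma open_functionally_open (R : realType) (Y : normedModType R) (O : set Y) :
  open O -> functionally_open R O.
Proof.
move=> /(@open_positivity_set R)[u [cu _ ->]].
by exists u, [set t | 0 < t]; split=> //; exact: open_gt.
Qed.

(** Off [K] the preimage of [O] is the set where both [e] and the continuous
    function defining [O] are positive, a union of closed sets where both are
    bounded below. *)
Lemma Fsigma_measurable_glue (R : realType) (X Y : topologicalType) (K : set X)
    (e : X -> R) (h : X -> Y) :
  continuous e -> (forall x, 0 <= e x) -> K = [set x | e x = 0] ->
  (forall x, 0 < e x -> {for x, continuous h}) ->
  (forall O, functionally_open R O -> Fsigma (K `&` h @^-1` O)) ->
  Fsigma_measurable R h.
Proof.
move=> ce e0 Ke ch hK O fO.
have [A cA AE] := hK O fO.
have [g [V [cg oV OV]]] := fO.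
have [u [cu u0 Vu]] := open_positivity_set oV.
pose p x := u (g (h x)).
have Op x : O (h x) <-> 0 < p x by rewrite OV /preimage Vu.
have cp x : 0 < e x -> {for x, continuous p}.
  move=> /ch chx; apply: (@continuous_comp X Y R h (u \o g)) => //.
  by apply: (@continuous_comp Y R R g u); [exact: cg|exact: cu].
pose E m := [set x | m.+1%:R^-1 <= e x /\ m.+1%:R^-1 <= p x].
have cE m : closed (E m).
  have m0 : 0 < m.+1%:R^-1 :> R by rewrite invr_gt0.
  rewrite -openC openE => x /not_andP nEx.
  have [ex|xe] := ltP (e x) (m.+1%:R^-1).
    apply: filterS (cvgr_lt _ (ce x) _ ex) => y ey [].
    by rewrite leNgt ey.
  have px : p x < m.+1%:R^-1.
    by rewrite ltNge; apply/negP; case: nEx => //; rewrite xe.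
  apply: filterS (cvgr_lt _ (cp x (lt_le_trans m0 xe)) _ px) => y py [_].
  by rewrite leNgt py.
exists (fun n => A n `|` E n); first by move=> n; exact: closedU.
apply/seteqP; split=> x.
  move=> Ox; have [Kx|nKx] := pselect (K x).
    have : (K `&` h @^-1` O) x by [].
    by rewrite AE => -[n _ Anx]; exists n => //; left.
  have ex : 0 < e x.
    by rewrite lt_neqAle e0 andbT eq_sym; apply/eqP => ex; apply: nKx; rewrite Ke.
  have /Op px := Ox.
  have q0 : 0 < Num.min (e x) (p x) by rewrite lt_min ex.
  exists (Num.truncn (Num.min (e x) (p x))^-1) => //; right.
  apply/andP; rewrite -le_min invf_ple ?posrE//.
  by rewrite ltW// Num.Theory.truncnS_gt.
move=> [n _ [Anx|[_ px]]].
  by have : (K `&` h @^-1` O) x by [rewrite AE; exists n]; case.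
by apply/Op; apply: lt_le_trans px; rewrite invr_gt0.
Qed.

Lemma closed_projection_along_compact (X Z : topologicalType) (A : set X)
    (D : set (X * Z)) :
  compact A -> closed D -> closed [set z | exists2 x, A x & D (x, z)].
Proof.
move=> cA clD; rewrite -openC openE => z nz.
have : \forall z' \near z, A `<=` (fun x => ~ D (x, z')).
  have /compact_near_coveringP := cA; apply => x Ax.
  have nD : ~ D (x, z) by move=> Dxz; apply: nz; exists x.
  have oD : open (~` D) by rewrite openC.
  have nbhsD : nbhs (x, z) (~` D) by exact: open_nbhs_nbhs.
  by apply: filterS nbhsD => -[x' z'].
by apply: filterS => z' nD [x Ax]; exact: nD.
Qed.

(** * Rays from a boundary point of a strictly convex set *)

Section StrictlyConvex.
Variables (R : realType) (X : topologicalLmodType R) (U : set X).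
Hypothesis oU : open U.
Hypothesis scU : strictly_convex U.

Lemma boundary_closure x : boundary U x -> closure U x.
Proof. by case. Qed.

Lemma open_boundary x : boundary U x -> ~ U x.
Proof. by case=> _ + Ux; apply; rewrite (interior_id _).1. Qed.

(** An open condition on pairs that holds for distinct boundary points. The
    midpoint and the reflection serve as definite witnesses that the chord
    enters [U] before [y] and leaves its closure after [y]. *)
Definition crosses (x y : X) : Prop :=
  U ((1 - 2^-1) *: x + 2^-1 *: y) /\ ~ closure U (y + (y - x)).

Lemma boundary_crosses x y :
  boundary U x -> boundary U y -> x <> y -> crosses x y.
Proof.
move=> bx bY xy; have half01 : 0 < (2^-1 : R) < 1.
  by rewrite invr_gt0 invf_lt1 ?ltr1n// ltr0n.
split.
  by apply: scU => //; exact: boundary_closure.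
move=> cz; apply: (open_boundary bY).
have mid : (1 - 2^-1 : R) *: x + (2^-1 : R) *: (y + (y - x)) = y.
  rewrite (_ : 1 - 2^-1 = 2^-1 :> R); last by field.
  rewrite !scalerDr scalerN addrC -addrA subrK -scalerDl.
  by rewrite (_ : 2^-1 + 2^-1 = 1 :> R) ?scale1r//; field.
have := scU (boundary_closure bx) cz _ half01; rewrite mid; apply => xz.
by apply: xy; rewrite -[RHS]mid -xz -scalerDl subrK scale1r.
Qed.

Lemma open_crosses : open [set p : X * X | crosses p.1 p.2].
Proof.
have cD (f g : X * X -> X) : continuous f -> continuous g ->
    continuous (fun p => f p + g p).
  move=> cf cg p; apply: (@continuous_comp _ (X * X)%type X
    (fun p => (f p, g p)) (fun q => q.1 + q.2)); last exact: add_continuous.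
  by apply: cvg_pair; [exact: cf|exact: cg].
have cZ (k : R) (f : X * X -> X) : continuous f -> continuous (fun p => k *: f p).
  move=> cf p; apply: (@continuous_comp _ (R^o * X)%type X
    (fun p => (k : R^o, f p)) (fun q => q.1 *: q.2)); last exact: scale_continuous.
  apply: (@cvg_pair _ _ _ _ (nbhs (k : R^o))); last exact: cf.
  exact: (@cvg_cst R^o).
have cfst : continuous (@fst X X) by move=> p; exact: cvg_fst.
have csnd : continuous (@snd X X) by move=> p; exact: cvg_snd.
have c1 : continuous (fun p : X * X => (1 - 2^-1 : R) *: p.1 + (2^-1 : R) *: p.2).
  exact: (cD _ _ (cZ _ _ cfst) (cZ _ _ csnd)).
have c2 : continuous (fun p : X * X => p.2 + (p.2 - p.1)).
  apply: (cD _ (fun p => p.2 - p.1)) => //; apply: (cD _ (fun p => - p.1)) => //.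
  move=> p; apply: (@continuous_comp _ X X fst -%R); first exact: cfst.
  exact: opp_continuous.
apply: openI.
  by apply: (open_comp _ oU) => p _; exact: c1.
apply: (@open_comp _ _ _ (~` closure U)) => [p _|]; first exact: c2.
by rewrite openC; exact: closed_closure.
Qed.

(** If the ray crosses at parameter [s1], then all its points with parameter
    strictly between [0] and [s1 / 2] are in [U], by strict convexity. For
    [s < s1 / 4] the reflection of [x], with parameter [2 * s], is among them. *)
Lemma ray_eventually_not_crosses x v : boundary U x ->
  exists2 d : R, 0 < d & forall s, 0 < s < d -> ~ crosses x (x + s *: v).
Proof.
move=> bx.
have [[s1 [s1_gt0 [Uz _]]]|none] :=
    pselect (exists s1 : R, 0 < s1 /\ crosses x (x + s1 *: v)).
  exists (s1 / 4); first by rewrite divr_gt0.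
  move=> s /andP[s0 ss1] [_]; apply; apply: subset_closure.
  set z := _ + _ in Uz.
  have xz : x <> z by move=> xz; apply: (open_boundary bx); rewrite xz.
  have t01 : 0 < 4 * s / s1 < 1.
    rewrite divr_gt0 ?mulr_gt0//= ltr_pdivrMr// mul1r.
    by move: ss1; rewrite ltr_pdivlMr// mulrC.
  have := scU (boundary_closure bx) (subset_closure Uz) xz t01.
  congr U; rewrite /z !scalerDr !scalerA addrA -scalerDl [RHS]addrA.
  rewrite addrA -scalerDl (_ : _ + _ / 2 = 1); last by ring.
  rewrite scale1r (_ : _ * s1 = s + s); last by field; rewrite gt_eqF.
  by apply/eqP; rewrite scalerDl eq_sym subr_eq addrACA [eqbRHS]addrAC.
exists 1 => // s /andP[s0 _] cs; apply: none; by exists s.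
Qed.

End StrictlyConvex.

(** * Linearly continuous extension *)

Lemma continuous_line (R : realType) (X : topologicalLmodType R) (x v : X) :
  continuous (fun t : R => x + t *: v).
Proof.
move=> t; apply: (@continuous_comp R (X * X)%type X
  (fun t => (x, t *: v)) (fun q => q.1 + q.2)); last exact: add_continuous.
apply: cvg_pair; first exact: cvg_cst.
apply: (@continuous_comp R (R^o * X)%type X
  (fun t => (t : R^o, v)) (fun q => q.1 *: q.2)); last exact: scale_continuous.
apply: (@cvg_pair _ _ _ _ (nbhs (t : R^o))); last exact: cvg_cst.
exact: (@cvg_id R^o).
Qed.

Lemma dist_convex_combination (R : realType) (Y : normedModType R)
    (a b z : Y) (s eps : R) : 0 <= s <= 1 ->
  `|a - z| < eps -> `|b - z| < eps -> `|a + s *: (b - a) - z| < eps.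
Proof.
move=> /andP[s0 s1] az bz.
have -> : a + s *: (b - a) - z = (1 - s) *: (a - z) + s *: (b - z).
  have -> : b - a = (b - z) - (a - z) by rewrite opprB addrA subrK.
  by rewrite addrAC scalerBr scalerBl scale1r [RHS]addrAC [LHS]addrA.
apply: le_lt_trans (ler_normD _ _) _; rewrite !normrZ !ger0_norm ?subr_ge0//.
pose m := Num.max `|a - z| `|b - z|.
have am : `|a - z| <= m by rewrite le_max lexx.
have bm : `|b - z| <= m by rewrite le_max lexx orbT.
apply: (@le_lt_trans _ _ ((1 - s) * m + s * m)); last first.
  by rewrite -mulrDl subrK mul1r gt_max az.
by apply: lerD; apply: ler_wpM2l => //; rewrite subr_ge0.
Qed.

Section Extension.
Variables (R : realType) (X : topologicalLmodType R) (Y : normedModType R).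
Variables (U K : set X) (F : nat -> X -> Y) (f : X -> Y).
Hypothesis oU : open U.
Hypothesis scU : strictly_convex U.
Hypothesis KU : K `<=` boundary U.
Hypothesis scK : sigma_compact K.
Hypothesis fcK : functionally_closed R K.
Hypothesis cF : forall n, continuous (F n).
Hypothesis Ff : forall x, K x -> F n x @[n --> \oo] --> f x.

(** The points [y] for which some [x] in the [n]-th compact piece of [K] has
    [F n y] far from [F n x] without crossing from [x] to [y] form a closed set,
    by compactness of the piece, and it misses [K] since distinct points of [K]
    cross. The gauge [e] is chosen not to be small on it. *)
Lemma gauge_controlling_oscillation : exists e : X -> R,
  [/\ continuous e, forall x, 0 <= e x, K = [set x | e x = 0] &
  forall x, K x -> \forall n \near \oo, forall y, e y <= n.+1%:R^-1 ->
    ~ crosses U x y -> `|F n y - F n x| < n.+1%:R^-1 /\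
      `|F n.+1 y - F n.+1 x| < n.+2%:R^-1].
Proof.
have [A cA KA] := scK.
pose B n := \big[setU/set0]_(i < n.+1) A i.
have BK n : B n `<=` K.
  by rewrite /B -bigcup_mkord KA => x [i _ Ax]; exists i.
pose C n := [set y | exists2 x, B n x &
  n.+1%:R^-1 <= `|F n y - F n x| /\ ~ crosses U x y].
have clC n : closed (C n).
  apply: (@closed_projection_along_compact X X (B n)
    ([set p | n.+1%:R^-1 <= `|F n p.2 - F n p.1|] `&`
     ~` [set p | crosses U p.1 p.2])).
    by apply: bigsetU_compact => i _.
  apply: closedI; last by apply: open_closedC; exact: open_crosses.
  apply: (@closed_comp _ _ (fun p : X * X => `|F n p.2 - F n p.1|)
    [set t | n.+1%:R^-1 <= t]); last exact: closed_ge.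
  move=> p _; apply: (@continuous_comp _ Y R (fun p : X * X => F n p.2 - F n p.1)
    Num.norm); last exact: norm_continuous.
  apply: cvgB.
    by apply: (@continuous_comp _ X Y snd (F n)); [exact: cvg_snd|exact: cF].
  by apply: (@continuous_comp _ X Y fst (F n)); [exact: cvg_fst|exact: cF].
have CK n y : K y -> ~ C n y.
  move=> Ky [x /BK Kx [Fyx]]; apply; apply: boundary_crosses => //.
  - exact: KU.
  - exact: KU.
  - by move=> xy; move: Fyx; rewrite xy subrr normr0 leNgt invr_gt0 ltr0n.
(* The shift by [2] makes [e y <= 1 / (n + 1)] exclude both [C n] and
   [C n.+1]. *)
have [e [ce e0 Ke eC]] := gauge_of_sigma_compact_zero_set
  (@topologicalZmod_completely_regular R X) scK fcK
  (fun n => clC n.+2) (fun n => @CK n.+2).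
exists e; split=> // x; rewrite KA => -[k _ Ax].
have BA n : (k <= n)%N -> B n x by move=> kn; rewrite /B -bigcup_mkord; exists k.
exists (maxn k 2) => // n /=; rewrite geq_max => /andP[kn n2] y ey ncr.
have far m : (2 <= m)%N -> (n <= m <= n.+1)%N -> ~ C m y.
  case: m => [|[|m]]// _ /andP[_]; rewrite ltnS => mn /eC /le_trans /(_ ey).
  by rewrite leNgt ltf_pV2 ?posrE// ltr_nat ltnS mn.
split; rewrite ltNge; apply/negP => Fle.
  by apply: (far n) => //; [rewrite leqnn leqnSn|exists x => //; exact: BA].
apply: (far n.+1); [exact: leq_trans n2 _|by rewrite leqnSn leqnn|].
by exists x => //; apply: BA; rewrite (leq_trans kn).
Qed.

(** Near a point [p] of [K] along a ray, crossing is excluded, so the two functions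
    being interpolated at [p + s *: v] are close to their values at [p], which
    are close to [f p]. *)
Lemma linearly_continuous_extension : exists (e : X -> R) (h : X -> Y),
  [/\ continuous e, forall x, 0 <= e x, K = [set x | e x = 0],
      forall x, 0 < e x -> {for x, continuous h} &
      linearly_continuous h /\ forall x, K x -> h x = f x].
Proof.
have [e [ce e0 Ke eF]] := gauge_controlling_oscillation.
have [G [cG GF]] := interpolate_along_gauge ce cF.
pose h x := if `[< K x >] then f x else G x.
have hK x : K x -> h x = f x by move=> Kx; rewrite /h asboolT.
have hG x : 0 < e x -> h x = G x.
  by move=> ex; rewrite /h asboolF// Ke /= => ex0; rewrite ex0 ltxx in ex.
have epos x : ~ K x -> 0 < e x.
  move=> nKx; rewrite lt_neqAle e0 andbT eq_sym; apply/eqP => ex.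
  by apply: nKx; rewrite Ke.
have ch x : 0 < e x -> {for x, continuous h}.
  move=> ex.
  suff : h y @[y --> x] --> G x by rewrite -hG.
  apply: cvg_trans (cG x ex); apply: near_eq_cvg.
  by apply: filterS (cvgr_gt _ (ce x) _ ex) => y ey; rewrite hG.
exists e, h; split=> //; split=> //.
have one_sided p v (eps : R) : K p -> 0 < eps -> exists2 d : R, 0 < d &
    forall s, 0 < s < d -> `|f p - h (p + s *: v)| < eps.
  move=> Kp eps0; have eps2 : 0 < eps / 2 by rewrite divr_gt0.
  have [d1 d1_gt0 ncr] := ray_eventually_not_crosses oU scU v (KU Kp).
  have [N near_f] : exists N, forall n y, (N <= n)%N ->
      e y <= n.+1%:R^-1 -> ~ crosses U p y ->
      `|F n y - f p| < eps /\ `|F n.+1 y - f p| < eps.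
    have [N1 _ N1P] := eF p Kp.
    have /cvgrPdist_lt/(_ _ eps2)[N2 _ N2P] := Ff Kp.
    pose N3 := Num.truncn (eps / 2)^-1.
    have N3P n : (N3 <= n)%N -> n.+1%:R^-1 < eps / 2.
      move=> n3; rewrite invf_plt ?posrE//.
      by rewrite (lt_le_trans (Num.Theory.truncnS_gt _))// ler_nat ltnS.
    exists (maxn N1 (maxn N2 N3)) => n y.
    rewrite !geq_max => /and3P[n1 n2 n3] ey nc.
    have close m : (N2 <= m)%N -> (N3 <= m)%N ->
        `|F m y - F m p| < m.+1%:R^-1 -> `|F m y - f p| < eps.
      move=> m2 m3 Fm; apply: le_lt_trans (ler_distD (F m p) _ _) _.
      rewrite [eps]splitr; apply: ltrD; first exact: lt_trans Fm (N3P m m3).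
      by rewrite distrC; exact: N2P.
    have [Fn Fn1] := N1P n n1 y ey nc.
    by split; apply: close => //; rewrite leqW.
  have ce0 : e (p + s *: v) @[s --> (0 : R)] --> (0 : R).
    have ep : e p = 0 by move: Kp; rewrite Ke.
    have : {for 0, continuous (fun s : R => e (p + s *: v))}.
      apply: (@continuous_comp R X R (fun s => p + s *: v) e); last exact: ce.
      exact: continuous_line.
    by rewrite /prop_for /continuous_at scale0r addr0 ep.
  have N0 : 0 < N.+1%:R^-1 :> R by rewrite invr_gt0.
  have [d2 /= d2_gt0 ed] := (cvgr_lt _ ce0 _ N0).
  exists (Num.min d1 d2); first by rewrite lt_min d1_gt0.
  move=> s; rewrite lt_min => /and3P[s0 sd1 sd2].
  have nc : ~ crosses U p (p + s *: v) by apply: ncr; rewrite s0.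
  have ey : e (p + s *: v) < N.+1%:R^-1.
    by apply: ed; rewrite /= sub0r normrN gtr0_norm.
  have [Ky|nKy] := pselect (K (p + s *: v)).
    have [<-|py] := pselect (p = p + s *: v); first by rewrite hK// subrr normr0.
    by case: nc; apply: boundary_crosses => //; exact: KU.
  have ey0 := epos _ nKy.
  rewrite hG//; have [n [r [Nn en r01 ->]]] := GF _ _ ey0 ey.
  have [Fn Fn1] := near_f n _ Nn en nc.
  by rewrite distrC; apply: dist_convex_combination.
move=> x v t; have [Kp|/epos ep] := pselect (K (x + t *: v)); last first.
  apply: (@continuous_comp R X Y (fun t => x + t *: v) h); last exact: ch.
  exact: continuous_line.
apply/cvgrPdist_lt => eps eps0; rewrite /= hK//.
have [d1 d1_gt0 h1] := one_sided _ v _ Kp eps0.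
have [d2 d2_gt0 h2] := one_sided _ (- v) _ Kp eps0.
exists (Num.min d1 d2) => /=; first by rewrite lt_min d1_gt0.
move=> s /=; rewrite lt_min => /andP[s1 s2].
have [st|ts|->] := ltgtP s t; last by rewrite hK// subrr normr0.
  have -> : x + s *: v = x + t *: v + (t - s) *: - v.
    by rewrite scalerN -scaleNr opprB -addrA -scalerDl addrC (addrC t) subrK addrC.
  by apply: h2; rewrite subr_gt0 st/= -[ltLHS]gtr0_norm ?subr_gt0.
have -> : x + s *: v = x + t *: v + (s - t) *: v.
  by rewrite -addrA -scalerDl (addrC t) subrK.
by apply: h1; rewrite subr_gt0 ts/= -[ltLHS]gtr0_norm ?subr_gt0// distrC.
Qed.

End Extension.

(* The domain of f is the subtype of X given by K, with the subspace topology
   (initial topology of the inclusion set_val). *)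
Theorem theorem1p7 (R : realType) (X : topologicalLmodType R)
    (hX : hausdorff_space X) (K : set X)
    (hKsc : sigma_compact K) (hKfc : functionally_closed R K)
    (U : set X) (hUo : open U) (hUsc : strictly_convex U)
    (hKU : K `<=` boundary U)
    (Y : completeNormedModType R) (f : K -> Y) (hf : Fsigma_measurable R f) :
  exists fbar : X -> Y,
    [/\ Fsigma_measurable R fbar,
        linearly_continuous fbar &
        forall x : K, fbar (set_val x) = f x].
Proof.
have clK : closed K by rewrite -openC; exact: functionally_open_open hKfc.
pose f0 (x : X) : Y := if pselect (K x) is left Kx then f (SigSub (mem_set Kx)) else 0.
have f0E (x : K) : f0 (set_val x) = f x.
  rewrite /f0; case: pselect => [Kx|]; last by case; exact: set_valP.
  by congr f; exact: val_inj.
have f0K O : open O -> Fsigma (K `&` f0 @^-1` O).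
  move=> oO; rewrite (_ : K `&` f0 @^-1` O = set_val @` (f @^-1` O)).
    by apply: Fsigma_image_set_val => //; apply: hf; exact: open_functionally_open.
  apply/seteqP; split=> [x [Kx Ox]|_ [x Ox <-]].
    by exists (SigSub (mem_set Kx)) => //; rewrite /= -f0E.
  by split; [exact: set_valP|rewrite /= f0E].
have crX := @topologicalZmod_completely_regular R X.
have [F [cF Ff]] := Fsigma_measurable_pointwise_limit hX crX hKsc f0K.
have [e [h [ce e0 Ke ch [lh hf0]]]] :=
  linearly_continuous_extension hUo hUsc hKU hKsc hKfc cF Ff.
exists h; split=> //; last by move=> x; rewrite hf0 ?f0E//; exact: set_valP.
apply: (Fsigma_measurable_glue ce e0 Ke ch) => O fO.
rewrite (_ : K `&` h @^-1` O = K `&` f0 @^-1` O).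
  by apply: f0K; exact: functionally_open_open fO.
by apply/seteqP; split=> x [Kx]; rewrite /= hf0.
Qed.
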